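(* Let $\varepsilon_{DM}=\varepsilon_{opt}$ and let $\mathcal M_{opt}=\{m_{opt},m_{opt}+1,\dots,N\}$. If $r(m)\le1$ for all $m\in\mathcal M_{opt}$, then $$\min_{m\in\mathcal M_{opt}}d_N^2(m)\le\min_{m\in\mathcal M_{opt}}d_N^{2,\sup}(m)<d_N^2(N),\qquad\text{where } d_N^{2,\sup}(m)=1+\frac{m}{N-1},$$ and consequently $$\min_{m\in\mathcal M_{opt}}d_N^2(m)\le1+\frac{m_{opt}}{N-1}<d_N^2(N).$$
   Context: $\mathbb M_{n,m}$ is the set of real $n\times m$ matrices; $\|\cdot\|$ is the Euclidean norm of vectors or Frobenius norm of matrices, $\langle[x],[y]\rangle_F=\mathrm{Tr}([x]^T[y])$. Data: $1\le\nu<N$ are integers, $\eta_d^1,\dots,\eta_d^N\in\mathbb R^\nu$ are given points, $[\eta_d]=[\eta_d^1\cdots\eta_d^N]\in\mathbb M_{\nu,N}$, with $\sum_j\eta_d^j=0$ and $\frac1{N-1}[\eta_d][\eta_d]^T=[I_\nu]$ (so $\|\eta_d\|^2=\nu(N-1)$). Set $s=\big(\frac4{N(\nu+2)}\big)^{1/(\nu+4)}$ and $\widehat s=s\big(s^2+\frac{N-1}N\big)^{-1/2}$. Diffusion-maps basis: for $\varepsilon_{DM}>0$, $[K]_{ij}=\exp\{-(4\varepsilon_{DM})^{-1}\|\eta_d^i-\eta_d^j\|^2\}$ is assumed positive definite, $[b]$ is diagonal with $[b]_{ii}=\sum_j[K]_{ij}$, $[\mathbb P]=[b]^{-1}[K]$.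 Its eigenvalues $1=\lambda_1>\lambda_2\ge\dots\ge\lambda_N$ and right eigenvectors $\psi^\alpha$ are normalized by $\langle[b]\psi^\alpha,\psi^\beta\rangle=\delta_{\alpha\beta}$; $\psi^1$ is a constant vector. For a fixed integer $\kappa\ge0$, $g^\alpha=\lambda_\alpha^\kappa\psi^\alpha=(g^\alpha_1,\dots,g^\alpha_N)$, $[g_m]=[g^1\cdots g^m]\in\mathbb M_{N,m}$, $[G_m]=[g_m]([g_m]^T[g_m])^{-1}[g_m]^T$, for $1\le m\le N$. Hypothesis on the data: there exist $\varepsilon_{opt}>0$ and an integer $m_{opt}$, $2<m_{opt}<N$, such that for $\varepsilon_{DM}=\varepsilon_{opt}$ one has $1=\lambda_1>\lambda_2\ge\dots\ge\lambda_{m_{opt}}\gg\lambda_{m_{opt}+1}\ge\dots\ge\lambda_N>0$ (where $\gg$ is a qualitative spectral gap). Random matrix: $[\mathbf H_m^N]=[\mathbf Z_m][g_m]^T$, where $[\mathbf Z_m]$ is a random matrix in $\mathbb M_{\nu,m}$ with pdf $p_{[\mathbf Z_m]}([z])=c_{\nu m}\prod_{\ell=1}^N\{\sum_{j=1}^N\exp\{-\frac1{2\widehat s^2}\|\frac{\widehat s}s\eta_d^j-\sum_{\alpha=1}^mz^\alpha g_\ell^\alpha\|^2\}\}$ ($z^\alpha\in\mathbb R^\nu$ the columns of $[z]$, $c_{\nu m}$ the normalization constant). The square of the relative distance is $d_N^2(m)=E\{\|[\mathbf H_m^N]-[\eta_d]\|^2\}/\|\eta_d\|^2$. Function $r$: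 let $\mathcal J=\{1,\dots,N\}^N$; for $\mathbf j=(j_1,\dots,j_N)\in\mathcal J$, $[\eta_d(\mathbf j)]=[\eta_d^{j_1}\cdots\eta_d^{j_N}]\in\mathbb M_{\nu,N}$, $[\eta_d^m]=[\eta_d][G_m]$, $[\eta_d^m(\mathbf j)]=[\eta_d(\mathbf j)][G_m]$, $\gamma_{\mathbf j}(m)=\exp\{-\frac1{2s^2}\|[\eta_d(\mathbf j)]-[\eta_d^m(\mathbf j)]\|^2\}$, $p_{\mathbf j}(m)=\gamma_{\mathbf j}(m)/\sum_{\mathbf j'\in\mathcal J}\gamma_{\mathbf j'}(m)$, $g_{\mathbf j}(m)=\|[\eta_d^m]-\frac{\widehat s}s[\eta_d^m(\mathbf j)]\|^2/\|\eta_d\|^2$, $\underline g(m)=N^{-N}\sum_{\mathbf j\in\mathcal J}g_{\mathbf j}(m)$ (which is $>0$), and $r(m)=\sum_{\mathbf j\in\mathcal J}p_{\mathbf j}(m)\,g_{\mathbf j}(m)/\underline g(m)$. *)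

(* Defs.v *)
From HB Require Import structures.
From mathcomp Require Import all_boot all_order all_algebra.
From mathcomp Require Import all_classical all_reals all_analysis.
Import Order.TTheory GRing.Theory Num.Theory.
Import numFieldNormedType.Exports.

Set Implicit Arguments.
Unset Strict Implicit.
Unset Printing Implicit Defensive.

Local Open Scope classical_set_scope.
Local Open Scope ring_scope.

Definition measure_mx_display : measure_display -> measure_display.
Proof. exact. Qed.

(* The product sigma-algebra; on real matrices this is the Borel one. *)
Section measurable_mx.
Context {d} {T : measurableType d} (m n : nat).

Definition mx_cylinders : set (set 'M[T]_(m, n)) :=
  [set B | exists (i : 'I_m) (j : 'I_n) (A : set T),
     measurable A /\ B = (fun z : 'M[T]_(m, n) => z i j) @^-1` A].

Let mx_measurable : set (set 'M[T]_(m, n)) := <<s mx_cylinders >>.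

Let mx_measurable0 : mx_measurable set0.
Proof. exact: sigma_algebra0. Qed.

Let mx_measurableC A : mx_measurable A -> mx_measurable (~` A).
Proof. exact: sigma_algebraC. Qed.

Let mx_measurable_bigcup (F : (set 'M[T]_(m, n))^nat) :
  (forall i, mx_measurable (F i)) -> mx_measurable (\bigcup_i F i).
Proof. exact: sigma_algebra_bigcup. Qed.

HB.instance Definition _ := @isMeasurable.Build (measure_mx_display d)
  'M[T]_(m, n) mx_measurable mx_measurable0 mx_measurableC
  mx_measurable_bigcup.

End measurable_mx.

(* Lebesgue measure on R^n by induction on n, then on real matrices through
   their m * n entries. *)
Section lebesgue_mx.
Context {R : realType}.

Definition tuple_cons n (xt : measurableTypeR R * n.-tuple R) :
  n.+1.-tuple R := [tuple of xt.1 :: xt.2].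

Definition tuple_uncons n (t : n.+1.-tuple R) :
  measurableTypeR R * n.-tuple R := (thead t, [tuple of behead t]).

Lemma tuple_consK n : cancel (@tuple_cons n) (@tuple_uncons n).
Proof. by move=> [x t]; congr pair; apply/val_inj. Qed.

Lemma measurable_tuple_cons n :
  measurable_fun [set: measurableTypeR R * n.-tuple R] (@tuple_cons n).
Proof. apply: measurable_cons; [exact: measurable_fst|exact: measurable_snd]. Qed.

Lemma measurable_tuple_uncons n :
  measurable_fun [set: n.+1.-tuple R] (@tuple_uncons n).
Proof.
apply: measurable_fun_pair; first exact: (measurable_tnth ord0).
exact: measurable_behead.
Qed.

HB.instance Definition _ n := isMeasurableFun.Build _ _ _ _
  (@tuple_cons n) (@measurable_tuple_cons n).

Section lebesgue_cons.
Variables (n : nat) (mu : {sigma_finite_measure set n.-tuple R -> \bar R}).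

Definition lebesgue_cons : set (n.+1.-tuple R) -> \bar R :=
  pushforward (@lebesgue_measure R \x mu)%E (@tuple_cons n).

Let lebesgue_cons0 : lebesgue_cons set0 = 0%E.
Proof. exact: measure0. Qed.

Let lebesgue_cons_ge0 A : (0 <= lebesgue_cons A)%E.
Proof. exact: measure_ge0. Qed.

Let lebesgue_cons_sigma_additive : semi_sigma_additive lebesgue_cons.
Proof. exact: measure_semi_sigma_additive. Qed.

HB.instance Definition _ := isMeasure.Build _ _ _ lebesgue_cons
  lebesgue_cons0 lebesgue_cons_ge0 lebesgue_cons_sigma_additive.

Let lebesgue_cons_sigma_finite : sigma_finite setT lebesgue_cons.
Proof.
have /sigma_finiteP[F [TF ndF Foo]] := sigma_finiteT (@lebesgue_measure R).
have /sigma_finiteP[G [TG ndG Goo]] := sigma_finiteT mu.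
pose H k := @tuple_uncons n @^-1` (F k `*` G k).
have HE k : @tuple_cons n @^-1` H k = F k `*` G k.
  rewrite /H -comp_preimage.
  by rewrite (_ : _ \o _ = id) ?preimage_id//; apply/funext/tuple_consK.
exists H.
  apply/seteqP; split => // t _.
  have [i _ Fi] : (\bigcup_i F i) (tuple_uncons t).1 by rewrite -TF.
  have [j _ Gj] : (\bigcup_j G j) (tuple_uncons t).2 by rewrite -TG.
  exists (maxn i j) => //; split.
    by move: Fi; apply/subsetPset/ndF; rewrite leq_maxl.
  by move: Gj; apply/subsetPset/ndG; rewrite leq_maxr.
move=> k; have [mF Fk] := Foo k; have [mG Gk] := Goo k; split.
  rewrite -[X in measurable X]setTI; apply: measurable_tuple_uncons => //.
  exact: measurableX.
rewrite /lebesgue_cons /pushforward HE product_measure1E//.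
by rewrite lte_mul_pinfty// ge0_fin_numE.
Qed.

HB.instance Definition _ := Measure_isSigmaFinite.Build _ _ _ lebesgue_cons
  lebesgue_cons_sigma_finite.

End lebesgue_cons.

Fixpoint lebesgue_tuple n : {sigma_finite_measure set n.-tuple R -> \bar R} :=
  match n with
  | 0 => [the {sigma_finite_measure set 0.-tuple R -> \bar R} of
            dirac ([tuple] : 0.-tuple R)]
  | n'.+1 => [the {sigma_finite_measure set n'.+1.-tuple R -> \bar R} of
            lebesgue_cons (lebesgue_tuple n')]
  end.

Variables (m n : nat).

Definition mx_of_tuple (t : (m * n).-tuple R) : 'M[R]_(m, n) :=
  \matrix_(i, j) tnth t (mxvec_index i j).

Lemma measurable_mx_of_tuple :
  measurable_fun [set: (m * n).-tuple R] mx_of_tuple.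
Proof.
apply: (measurability (@mx_cylinders _ R m n)) => //.
move=> _ [_ [i [j [A [mA ->]]]] <-].
rewrite setTI -comp_preimage.
rewrite (_ : _ \o _ = (@tnth _ R)^~ (mxvec_index i j)); last first.
  by apply/funext => t; rewrite /= mxE.
by rewrite -[X in measurable X]setTI; exact: measurable_tnth.
Qed.

HB.instance Definition _ := isMeasurableFun.Build _ _ _ _
  mx_of_tuple measurable_mx_of_tuple.

Definition lebesgue_mx : set 'M[R]_(m, n) -> \bar R :=
  pushforward (lebesgue_tuple (m * n)) mx_of_tuple.

Let lebesgue_mx0 : lebesgue_mx set0 = 0%E.
Proof. exact: measure0. Qed.

Let lebesgue_mx_ge0 A : (0 <= lebesgue_mx A)%E.
Proof. exact: measure_ge0. Qed.

Let lebesgue_mx_sigma_additive : semi_sigma_additive lebesgue_mx.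
Proof. exact: measure_semi_sigma_additive. Qed.

HB.instance Definition _ := isMeasure.Build _ _ _ lebesgue_mx
  lebesgue_mx0 lebesgue_mx_ge0 lebesgue_mx_sigma_additive.

End lebesgue_mx.
Arguments lebesgue_mx {R m n}.

Definition has_pdf (R : realType) (d : measure_display) (Omega : measurableType d)
    (P : probability Omega R) (m n : nat) (Z : {RV P >-> 'M[R]_(m, n)})
    (p : 'M[R]_(m, n) -> R) : Prop :=
  forall A : set 'M[R]_(m, n), measurable A ->
    distribution P Z A = (\int[lebesgue_mx]_(z in A) (p z)%:E)%E.

(* Mathcomp-Analysis' norm on matrices is the sup norm, hence this explicit
   Euclidean/Frobenius structure. *)
Definition frob_inner (R : realType) (m n : nat) (x y : 'M[R]_(m, n)) : R :=
  \tr (x^T *m y).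

Definition frob_norm (R : realType) (m n : nat) (x : 'M[R]_(m, n)) : R :=
  Num.sqrt (frob_inner x x).

Definition posdef_mx (R : realType) (n : nat) (A : 'M[R]_n) : Prop :=
  A^T = A /\ forall x : 'cV[R]_n, x != 0 -> 0 < frob_inner x (A *m x).

Section diffusion_maps.
Context {R : realType} (nu N : nat).
Variable eta : 'M[R]_(nu, N).

Definition normalized_data : Prop :=
  \sum_j col j eta = 0 /\ (N%:R - 1)^-1 *: (eta *m eta^T) = 1%:M.

Definition dm_kernel (eps : R) : 'M[R]_N :=
  \matrix_(i, j) expR (- ((4 * eps)^-1 * frob_norm (col i eta - col j eta) ^+ 2)).

Definition dm_degree (eps : R) : 'M[R]_N :=
  diag_mx (\row_i \sum_j dm_kernel eps i j).

Definition dm_transition (eps : R) : 'M[R]_N :=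
  invmx (dm_degree eps) *m dm_kernel eps.

(* The families are numbered from 1 to N; their values elsewhere are unused. *)
Record diffusion_basis (eps : R) (lam : nat -> R) (psi : nat -> 'cV[R]_N) :
    Prop := DiffusionBasis {
  dm_eigen : forall a, (1 <= a <= N)%N ->
    dm_transition eps *m psi a = lam a *: psi a;
  dm_orthonormal : forall a b, (1 <= a <= N)%N -> (1 <= b <= N)%N ->
    frob_inner (dm_degree eps *m psi a) (psi b) = (a == b)%:R;
  dm_lam1 : lam 1%N = 1;
  dm_lam2 : lam 2%N < lam 1%N;
  dm_lam_noninc : forall a, (2 <= a < N)%N -> lam a.+1 <= lam a;
  dm_psi1 : exists c : R, psi 1%N = const_mx c
}.

Definition bw_s : R :=
  (4 / (N%:R * (nu%:R + 2))) `^ (nu%:R + 4)^-1.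

Definition bw_shat : R :=
  bw_s * (Num.sqrt (bw_s ^+ 2 + (N%:R - 1) / N%:R))^-1.

Variables (kappa : nat) (lam : nat -> R) (psi : nat -> 'cV[R]_N).

Definition g_vec (a : nat) : 'cV[R]_N := lam a ^+ kappa *: psi a.

Definition g_mx (m : nat) : 'M[R]_(N, m) :=
  \matrix_(l < N, a < m) g_vec a.+1 l ord0.

Definition G_mx (m : nat) : 'M[R]_N :=
  g_mx m *m invmx ((g_mx m)^T *m g_mx m) *m (g_mx m)^T.

Definition unnorm_pdf (m : nat) (z : 'M[R]_(nu, m)) : R :=
  \prod_(l < N) \sum_(j < N)
    expR (- ((2 * bw_shat ^+ 2)^-1 *
      frob_norm ((bw_shat / bw_s) *: col j eta
                 - \sum_(a < m) g_mx m l a *: col a z) ^+ 2)).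

Definition pdf_const (m : nat) : R :=
  (fine (\int[lebesgue_mx]_(z in [set: 'M[R]_(nu, m)]) (unnorm_pdf z)%:E)%E)^-1.

Definition pdf_Z (m : nat) (z : 'M[R]_(nu, m)) : R :=
  pdf_const m * unnorm_pdf z.

Definition d2 (d : measure_display) (Omega : measurableType d)
    (P : probability Omega R) (Z : forall m : nat, {RV P >-> 'M[R]_(nu, m)})
    (m : nat) : \bar R :=
  ('E_P[fun w => (frob_norm (Z m w *m (g_mx m)^T - eta) ^+ 2)%R]
     * ((frob_norm eta ^+ 2)^-1)%:E)%E.

Definition d2_sup (m : nat) : R := 1 + m%:R / (N%:R - 1).

(* [colsub j eta] has columns eta^(j_1), ..., eta^(j_N). *)
Definition gamma_j (m : nat) (j : {ffun 'I_N -> 'I_N}) : R :=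
  expR (- ((2 * bw_s ^+ 2)^-1 *
    frob_norm (colsub j eta - colsub j eta *m G_mx m) ^+ 2)).

Definition p_j (m : nat) (j : {ffun 'I_N -> 'I_N}) : R :=
  gamma_j m j / \sum_(j' : {ffun 'I_N -> 'I_N}) gamma_j m j'.

Definition g_j (m : nat) (j : {ffun 'I_N -> 'I_N}) : R :=
  frob_norm (eta *m G_mx m
             - (bw_shat / bw_s) *: (colsub j eta *m G_mx m)) ^+ 2
  / frob_norm eta ^+ 2.

Definition g_mean (m : nat) : R :=
  (N%:R ^+ N)^-1 * \sum_(j : {ffun 'I_N -> 'I_N}) g_j m j.

Definition r_fun (m : nat) : R :=
  \sum_(j : {ffun 'I_N -> 'I_N}) p_j m j * (g_j m j / g_mean m).

End diffusion_maps.

(* Minimum of f over {a, ..., b}, for a <= b; the default value f b is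
   attained on the range. *)
Definition min_range (disp : Order.disp_t) (T : orderType disp) (a b : nat)
    (f : nat -> T) : T :=
  \big[Order.min/f b]_(a <= m < b.+1) f m.

(* Main.v *)
Require Import Defs.
From mathcomp Require Import all_boot all_order all_algebra.
From mathcomp Require Import all_classical all_reals all_analysis.
From mathcomp Require Import measurable_realfun ring lra.
Import Order.TTheory GRing.Theory Num.Theory.
Import numFieldNormedType.Exports.

Set Implicit Arguments.
Unset Strict Implicit.
Unset Printing Implicit Defensive.

Local Open Scope classical_set_scope.
Local Open Scope ring_scope.

(** The density of Z_m is a product over the N columns of sums over the N data
    points.  Expanded, it is a sum over the maps j : {ffun 'I_N -> 'I_N}, and the
    orthogonal projector G = g (g^T g)^-1 g^T splits each exponent by Pythagoras:
    the part orthogonal to the columns of g does not involve z and is the weight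
    gamma_j, the other part is a Gaussian in z centred at
    mu_j = (shat / s) eta(j) g (g^T g)^-1 ([unnorm_pdf_mixture]).  So Z_m is a
    mixture, with weights p_j(m), of Gaussians that differ only by their centres,
    and ([expectation_gauss_mixture])
      E |Z_m g^T - eta|^2
        = sum_j p_j (nu m shat^2 + |(shat / s) eta(j) G - eta|^2).
    On the other side, the data have rows of zero sum and squared norm
    nu (N - 1), so all cross terms vanish in the uniform average of g_j over j
    ([mean_resampled_distance], [g_meanE]):
      gbar(m) = |eta G|^2 / |eta|^2 + (shat / s)^2 m / N.
    Since (shat / s)^2 (s^2 + (N - 1) / N) = 1, the two formulas combine into the
    identity ([d2E])
      d2(m) = d2_sup(m) + (r(m) - 1) gbar(m),       gbar(m) > 0.
    Hence d2(m) <= d2_sup(m) wherever r(m) <= 1.  For m = N the basis is complete,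
    G = 1, all the weights p_j are equal, r(N) = 1 and d2(N) = d2_sup(N).  The
    theorem follows because d2_sup is strictly increasing in m.

    The Gaussian integrals are computed without any linear change of variables,
    from the behaviour of Lebesgue measure under z |-> c z + v alone
    ([ge0_integral_affine_mx]).  Let Q(z) = beta |z g^T|^2 and let I be the
    integral of exp(-Q).  Translations reduce every centre to 0, and the symmetry
    z |-> -z with the parallelogram identity removes the terms linear in z
    ([gauss_second_moment]).  The integral of Q exp(-Q) is (nu m / 2) I because
    Q(c z) = c^2 Q(z) ([integral_quad_expN]).  The value of I cancels; that it is
    finite and nonzero follows from the total mass of the law of Z_m being 1. *)

(** * Lebesgue measure under homotheties and translations *)

Lemma lebesgue_itv_affine (R : realType) (c v a b : R) : c != 0 ->
  lebesgue_measure (`]a, b]%classic : set R) =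
  (`|c|%:E * lebesgue_measure ((fun x : R => (c * x + v)%R) @^-1` `]a, b]%classic))%E.
Proof.
move=> c0; case: (ltgtP 0 c) (c0) => // {c0} [c0|c0] _.
- have -> : (fun x : R => c * x + v) @^-1` `]a, b]%classic =
     `](a - v) / c, (b - v) / c]%classic.
    apply/seteqP; split => x /=; rewrite !in_itv/= ltr_pdivrMr// ler_pdivlMr//;
      rewrite (mulrC x); lra.
  rewrite !lebesgue_measure_itv/= !lte_fin ltr_pM2r ?invr_gt0// gtr0_norm//.
  rewrite ltrD2r; case: ifP => _; last by rewrite mule0.
  rewrite -!EFinD -EFinM; congr EFin; field; lra.
- have -> : (fun x : R => c * x + v) @^-1` `]a, b]%classic =
     `[(b - v) / c, (a - v) / c[%classic.
    apply/seteqP; split => x /=; rewrite !in_itv/= ltr_ndivlMr// ler_ndivrMr//;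
      rewrite (mulrC x); lra.
  rewrite !lebesgue_measure_itv/= !lte_fin ltr_nM2r ?invr_lt0// ltr0_norm//.
  rewrite ltrD2r; case: ifP => _; last by rewrite mule0.
  rewrite -!EFinD -EFinM; congr EFin; field; lra.
Qed.

(** Lebesgue measure is determined by its values on half-open intervals, so it
    equals its image under x |-> c x + v multiplied by |c|. *)
Lemma ge0_integral_affine (R : realType) (c v : R) (f : R -> \bar R) :
  c != 0 -> measurable_fun setT f -> (forall x, (0 <= f x)%E) ->
  (`|c|%:E * \int[@lebesgue_measure R]_x f (c * x + v)%R =
   \int[@lebesgue_measure R]_x f x)%E.
Proof.
move=> c0 mf f0.
pose phi : measurableTypeR R -> measurableTypeR R := fun x => c * x + v.
have mphi : measurable_fun setT phi.
  by apply: measurable_funD => //; apply: measurable_funM.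
pose nu := mscale (NngNum (normr_ge0 c)) (pushforward (@lebesgue_measure R) phi).
have lebesgue_nu A : measurable A -> lebesgue_measure A = nu mphi A.
  apply: lebesgue_measure_unique => _ [[a b] _ <-].
  exact: lebesgue_itv_affine.
rewrite [RHS](eq_measure_integral (nu mphi)); last first.
  by move=> A mA _; exact: lebesgue_nu.
by rewrite ge0_integral_mscale// ge0_integral_pushforward.
Qed.

Definition affine_tuple (R : realType) n (c : R) (v t : n.-tuple R) :
  n.-tuple R := [tuple c * tnth t i + tnth v i | i < n].

Lemma measurable_affine_tuple (R : realType) n (c : R) (v : n.-tuple R) :
  measurable_fun setT (affine_tuple c v).
Proof.
apply/measurable_fun_tnthP => i.
rewrite (_ : _ \o _ = fun t => c * tnth t i + tnth v i); last first.
  by apply/funext => t /=; rewrite tnth_mktuple.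
apply: measurable_funD => //; apply: measurable_funM => //.
exact: measurable_tnth.
Qed.

Lemma ge0_integral_lebesgue_cons (R : realType) n
    (mu : {sigma_finite_measure set n.-tuple R -> \bar R})
    (f : n.+1.-tuple R -> \bar R) :
  measurable_fun setT f -> (forall x, (0 <= f x)%E) ->
  (\int[lebesgue_cons mu]_t f t =
   \int[@lebesgue_measure R]_x \int[mu]_t f (tuple_cons (x, t)))%E.
Proof.
move=> mf f0; rewrite /lebesgue_cons ge0_integral_pushforward//.
rewrite preimage_setT fubini_tonelli1//=.
by apply: measurableT_comp => //; exact: measurable_tuple_cons.
Qed.

(** Induction on the dimension: by Tonelli, the first coordinate contributes one
    factor |c| and the remaining ones |c| ^+ n. *)
Lemma ge0_integral_affine_tuple (R : realType) n (c : R) (v : n.-tuple R)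
    (f : n.-tuple R -> \bar R) :
  c != 0 -> measurable_fun setT f -> (forall x, (0 <= f x)%E) ->
  ((`|c| ^+ n)%:E * \int[lebesgue_tuple n]_t f (affine_tuple c v t) =
   \int[lebesgue_tuple n]_t f t)%E.
Proof.
move=> c0; elim: n v f => [|n IHn] v f mf f0.
  rewrite expr0 mul1e; apply: eq_integral => t _.
  by rewrite [affine_tuple _ _ _]tuple0 [t]tuple0.
have mfa : measurable_fun setT (fun t => f (affine_tuple c v t)).
  by apply: measurableT_comp mf (measurable_affine_tuple c v).
have mcons (x : R) : measurable_fun setT (fun t => tuple_cons (x, t) : n.+1.-tuple R).
  by apply: measurableT_comp; [exact: measurable_tuple_cons|exact: pair1_measurable].
have affine_cons (x : R) (t : n.-tuple R) : affine_tuple c v (tuple_cons (x, t)) =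
    tuple_cons (c * x + thead v, affine_tuple c [tuple of behead v] t).
  apply: eq_from_tnth => i; rewrite tnth_mktuple.
  case: (unliftP ord0 i) => [j ->|->]; last by rewrite /tuple_cons/= !tnth0.
  by rewrite /tuple_cons/= !tnthS tnth_mktuple tnth_behead
    (_ : inord _ = lift ord0 j)//; apply/val_inj; rewrite /= inordK// ltnS.
rewrite /= !ge0_integral_lebesgue_cons//.
under eq_integral do under eq_integral do rewrite affine_cons.
pose F (x : measurableTypeR R) := (\int[lebesgue_tuple n]_t f (tuple_cons (x, t)))%E.
have F0 x : (0 <= F x)%E by exact: integral_ge0.
have mF : measurable_fun setT F.
  apply: (@measurable_fun_fubini_tonelli_F _ _ _ _ _ (lebesgue_tuple n)
     (f \o (@tuple_cons R n))) => //=.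
  by apply: measurableT_comp => //; exact: measurable_tuple_cons.
rewrite -(ge0_integral_affine (thead v) c0 mF F0) exprS EFinM -muleA; congr (_ * _)%E.
rewrite -ge0_integralZl//; last first.
- by move=> x _; exact: integral_ge0.
- under eq_fun do under eq_integral do rewrite -affine_cons.
  apply: (@measurable_fun_fubini_tonelli_F _ _ _ _ _ (lebesgue_tuple n)
     (fun xt => f (affine_tuple c v (tuple_cons xt)))) => //=.
  by apply: (measurableT_comp mfa); exact: measurable_tuple_cons.
apply: eq_integral => x _; rewrite /F.
rewrite -(IHn [tuple of behead v] (fun t => f (tuple_cons (c * x + thead v, t))))//.
exact: measurableT_comp.
Qed.

Lemma measurable_mxP (R : realType) m n d (T : measurableType d)
    (f : T -> 'M[R]_(m, n)) :
  (forall i j, measurable_fun setT (fun t => f t i j)) -> measurable_fun setT f.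
Proof.
move=> mf; apply: (measurability (@mx_cylinders _ R m n)) => //.
move=> _ [_ [i [j [A [mA ->]]]] <-].
by rewrite setTI -comp_preimage -[X in measurable X]setTI; exact: mf.
Qed.

Lemma measurable_mx_entry (R : realType) m n (i : 'I_m) (j : 'I_n) :
  measurable_fun setT (fun z : 'M[R]_(m, n) => z i j).
Proof.
move=> _ A mA; rewrite setTI; apply: sub_sigma_algebra.
by exists i, j, A.
Qed.

Lemma measurable_affine_mx (R : realType) m n (c : R) (v : 'M[R]_(m, n)) :
  measurable_fun setT (fun z : 'M[R]_(m, n) => c *: z + v).
Proof.
apply: measurable_mxP => i j; under eq_fun do rewrite !mxE.
by apply: measurable_funD => //; apply: measurable_funM => //;
  exact: measurable_mx_entry.
Qed.

Lemma ge0_integral_affine_mx (R : realType) m n (c : R) (v : 'M[R]_(m, n))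
    (f : 'M[R]_(m, n) -> \bar R) :
  c != 0 -> measurable_fun setT f -> (forall z, (0 <= f z)%E) ->
  ((`|c| ^+ (m * n))%:E * \int[lebesgue_mx]_z f (c *: z + v)%R =
   \int[lebesgue_mx]_z f z)%E.
Proof.
move=> c0 mf f0; have mt := @measurable_mx_of_tuple R m n.
rewrite /lebesgue_mx !ge0_integral_pushforward//; last first.
  by apply: measurableT_comp mf _; exact: measurable_affine_mx.
rewrite !preimage_setT.
pose w := [tuple mxvec v ord0 k | k < m * n].
rewrite -(ge0_integral_affine_tuple w c0 (f := f \o @mx_of_tuple R m n))//; last 2 first.
- exact: measurableT_comp.
- by move=> t; exact: f0.
congr (_ * _)%E; apply: eq_integral => t _ /=; congr f.
by apply/matrixP => i j; rewrite !mxE !tnth_mktuple mxvecE.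
Qed.

(** * Integration against a law with a density *)

Import HBNNSimple.

(** For indicators this is the hypothesis on [nu]; it extends to simple functions
    by linearity and to nonnegative functions by monotone convergence. *)
Lemma ge0_integral_density d (T : measurableType d) (R : realType)
    (mu nu : {measure set T -> \bar R}) (p : T -> R) (f : T -> \bar R) :
  measurable_fun setT p -> (forall x, 0 <= p x) ->
  (forall A, measurable A -> nu A = \int[mu]_(x in A) (p x)%:E)%E ->
  measurable_fun setT f -> (forall x, 0 <= f x)%E ->
  (\int[nu]_x f x = \int[mu]_x (f x * (p x)%:E))%E.
Proof.
move=> mp p0 nup mf f0.
have mEp : measurable_fun setT (EFin \o p) by exact/measurable_EFinP.
pose h := nnsfun_approx measurableT mf.
have hf x : EFin (h k x) @[k --> \oo] --> f x by exact: cvg_nnsfun_approx.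
have ndh x : {homo (fun k => h k x) : a b / (a <= b)%N >-> a <= b}.
  by move=> a b ab; exact/lefP/nd_nnsfun_approx.
transitivity (limn (fun k => \int[nu]_x (h k x)%:E)%E).
  rewrite -monotone_convergence//.
  - by apply: eq_integral => x _; apply/esym/cvg_lim.
  - by move=> k; exact/measurable_EFinP.
  - by move=> k x _; rewrite lee_fin.
  - by move=> x _ a b ab; rewrite lee_fin; exact: ndh.
transitivity (limn (fun k => \int[mu]_x ((h k x)%:E * (p x)%:E))%E); last first.
  rewrite -monotone_convergence//.
  - by apply: eq_integral => x _; apply/cvg_lim => //; exact: cvgeZr.
  - by move=> k; apply: emeasurable_funM => //; exact/measurable_EFinP.
  - by move=> k x _; rewrite mule_ge0// lee_fin.
  - by move=> x _ a b ab; rewrite lee_wpmul2r ?lee_fin//; exact: ndh.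
congr (limn _); apply/funext => k.
under eq_integral do rewrite fimfunE -fsumEFin//.
under [RHS]eq_integral do rewrite fimfunE -fsumEFin//.
have mind r : measurable_fun setT (fun x => (r * \1_(h k @^-1` [set r]) x)%:E).
  by apply/measurable_EFinP; exact: measurable_funM.
have ind0 r x : (0 <= (r * \1_(h k @^-1` [set r]) x)%:E)%E.
  by rewrite EFinM nnfun_muleindic_ge0.
rewrite ge0_integral_fsum//.
under [RHS]eq_integral do rewrite ge0_mule_fsuml//.
rewrite ge0_integral_fsum//; last 2 first.
- by move=> r; apply: emeasurable_funM.
- by move=> r x _; rewrite mule_ge0// lee_fin.
apply: eq_fsbigr => r _.
rewrite integralZl_indic_nnsfun// integral_indic// setIT nup//.
(* A negative value r is not taken, so that its level set is empty. *)
have [r0|r0] := ltP r 0.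
  rewrite preimage_nnfun0// integral_set0 mule0.
  by under eq_integral do rewrite indic0 mulr0 mul0e; rewrite integral0.
rewrite -ge0_integralZl//; [|exact: measurable_funTS|by move=> x _; rewrite lee_fin].
rewrite integral_mkcond; apply: eq_integral => x _; rewrite patchE indicE.
by case: ifPn; rewrite ?mulr1// mulr0 mul0e.
Qed.

(** * The Frobenius inner product *)

Lemma frob_innerE (R : realType) m n (x y : 'M[R]_(m, n)) :
  frob_inner x y = \sum_j \sum_i x i j * y i j.
Proof.
rewrite /frob_inner /mxtrace; apply: eq_bigr => j _; rewrite mxE.
by apply: eq_bigr => i _; rewrite mxE.
Qed.

Lemma frob_inner_ge0 (R : realType) m n (x : 'M[R]_(m, n)) : 0 <= frob_inner x x.
Proof.
rewrite frob_innerE; apply: sumr_ge0 => j _; apply: sumr_ge0 => i _.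
by rewrite -expr2 sqr_ge0.
Qed.

Lemma frob_norm_sqr (R : realType) m n (x : 'M[R]_(m, n)) :
  frob_norm x ^+ 2 = frob_inner x x.
Proof. by rewrite sqr_sqrtr// frob_inner_ge0. Qed.

Lemma frob_innerDl (R : realType) m n (x y z : 'M[R]_(m, n)) :
  frob_inner (x + y) z = frob_inner x z + frob_inner y z.
Proof. by rewrite /frob_inner linearD mulmxDl linearD. Qed.

Lemma frob_innerC (R : realType) m n (x y : 'M[R]_(m, n)) :
  frob_inner x y = frob_inner y x.
Proof. by rewrite /frob_inner -mxtrace_tr trmx_mul trmxK. Qed.

Lemma frob_innerZl (R : realType) m n (a : R) (x y : 'M[R]_(m, n)) :
  frob_inner (a *: x) y = a * frob_inner x y.
Proof. by rewrite /frob_inner linearZ -scalemxAl linearZ. Qed.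

Lemma frob_innerDr (R : realType) m n (x y z : 'M[R]_(m, n)) :
  frob_inner x (y + z) = frob_inner x y + frob_inner x z.
Proof. by rewrite !(frob_innerC x) frob_innerDl. Qed.

Lemma frob_innerZr (R : realType) m n (a : R) (x y : 'M[R]_(m, n)) :
  frob_inner x (a *: y) = a * frob_inner x y.
Proof. by rewrite !(frob_innerC x) frob_innerZl. Qed.

Lemma frob_norm_sqrD (R : realType) m n (x y : 'M[R]_(m, n)) :
  frob_norm (x + y) ^+ 2 =
  frob_norm x ^+ 2 + 2 * frob_inner x y + frob_norm y ^+ 2.
Proof.
rewrite !frob_norm_sqr frob_innerDl !frob_innerDr (frob_innerC y x); ring.
Qed.

Lemma frob_norm_sqrZ (R : realType) m n (a : R) (x : 'M[R]_(m, n)) :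
  frob_norm (a *: x) ^+ 2 = a ^+ 2 * frob_norm x ^+ 2.
Proof. by rewrite !frob_norm_sqr frob_innerZl frob_innerZr mulrA expr2. Qed.

Lemma frob_norm_sqrN (R : realType) m n (x : 'M[R]_(m, n)) :
  frob_norm (- x) ^+ 2 = frob_norm x ^+ 2.
Proof. by rewrite -scaleN1r frob_norm_sqrZ sqrrN expr1n mul1r. Qed.

(** * Moments of a Gaussian mixture *)

Section nonneg_combinations.
Context d (T : measurableType d) (R : realType).
Variable mu : {measure set T -> \bar R}.

Lemma ge0_integral_lincomb (a b : R) (f g : T -> R) :
  0 <= a -> 0 <= b -> (forall x, 0 <= f x) -> (forall x, 0 <= g x) ->
  measurable_fun setT f -> measurable_fun setT g ->
  (\int[mu]_x (a * f x + b * g x)%:E =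
   a%:E * \int[mu]_x (f x)%:E + b%:E * \int[mu]_x (g x)%:E)%E.
Proof.
move=> a0 b0 f0 g0 mf mg.
rewrite -ge0_integralZl//; last 2 first.
- exact/measurable_EFinP.
- by move=> x _; rewrite lee_fin.
rewrite -ge0_integralZl//; last 2 first.
- exact/measurable_EFinP.
- by move=> x _; rewrite lee_fin.
rewrite -ge0_integralD//.
- by move=> x _; rewrite -EFinM lee_fin mulr_ge0.
- by apply: measurable_funeM; exact/measurable_EFinP.
- by move=> x _; rewrite -EFinM lee_fin mulr_ge0.
- by apply: measurable_funeM; exact/measurable_EFinP.
Qed.

Lemma ge0_integral_fincomb (J : finType) (a : J -> R) (f : J -> T -> R) :
  (forall j, 0 <= a j) -> (forall j x, 0 <= f j x) ->
  (forall j, measurable_fun setT (f j)) ->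
  (\int[mu]_x (\sum_j a j * f j x)%:E =
   \sum_j (a j)%:E * \int[mu]_x (f j x)%:E)%E.
Proof.
move=> a0 f0 mf; under eq_integral do rewrite -sumEFin.
rewrite ge0_integral_sum//.
- apply: eq_bigr => j _; under eq_integral do rewrite EFinM.
  rewrite ge0_integralZl//.
  + exact/measurable_EFinP.
  + by move=> x _; rewrite lee_fin.
  + by rewrite lee_fin.
- by move=> j; apply/measurable_EFinP; exact: measurable_funM.
- by move=> j x _; rewrite lee_fin mulr_ge0.
Qed.

End nonneg_combinations.

Lemma measurable_frob_norm_sqr (R : realType) m n d (T : measurableType d)
    (f : T -> 'M[R]_(m, n)) :
  measurable_fun setT f -> measurable_fun setT (fun t => frob_norm (f t) ^+ 2).
Proof.
move=> mf; under eq_fun do rewrite frob_norm_sqr frob_innerE.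
apply: measurable_sum => j; apply: measurable_sum => i.
have mij : measurable_fun setT (fun t => f t i j).
  exact: (measurableT_comp (measurable_mx_entry i j) mf).
exact: measurable_funM.
Qed.

Lemma measurable_mulmxr (R : realType) m n p (A : 'M[R]_(n, p)) :
  measurable_fun setT (fun z : 'M[R]_(m, n) => z *m A).
Proof.
apply: measurable_mxP => i j; under eq_fun do rewrite mxE.
apply: measurable_sum => k; apply: measurable_funM => //.
exact: measurable_mx_entry.
Qed.

(** The polynomial in the hypothesis vanishes at x = 1, which is therefore a
    minimum over the positive reals; its derivative k I - 2 J is zero there. *)
Lemma ge0_deriv_at_1 (R : realType) (k : nat) (I J : R) :
  (forall x, 0 < x -> 0 <= I * (x ^+ k.+2 - x ^+ 2) - J * (x ^+ 2 - 1)) ->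
  J = k%:R / 2 * I.
Proof.
move=> ge0.
pose q l : {poly R} := I *: ('X^l - 'X^2) - J *: ('X^2 - 1).
have qE l x : (q l).[x] = I * (x ^+ l - x ^+ 2) - J * (x ^+ 2 - 1).
  by rewrite /q !hornerE.
have q1 l : (q l).[1] = 0 by rewrite qE !expr1n !subrr !mulr0 subrr.
have dq1 l : (q l)^`().[1] = I * (l%:R - 2) - J * 2.
  rewrite /q derivB !derivZ !derivB !derivXn derivC.
  by rewrite !(hornerD, hornerN, hornerZ, hornerMn, hornerXn, hornerC) !expr1n subr0.
have min1 : is_derive (1 : R) 1 (horner (q k.+2)) 0.
  apply: (@derive1_at_min _ _ 0 2) => //.
  - by rewrite in_itv/= ltr01/= ltr1n.
  - by move=> x; rewrite in_itv/= => /andP[x0 _]; rewrite q1 qE ge0.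
have := @derive_val _ _ _ _ _ _ _ min1.
rewrite -derive1E -derivE dq1 -addn2 natrD; lra.
Qed.

Section quadratic_exponential.
Context {R : realType} {m n : nat}.
Variable Q : 'M[R]_(m, n) -> R.
Hypothesis mQ : measurable_fun setT Q.
Hypothesis Q0 : forall z, 0 <= Q z.
Hypothesis Q_homo : forall c z, Q (c *: z) = c ^+ 2 * Q z.

(** Euler's relation for a function homogeneous of degree 2, in integrated form.
    By scaling, exp (- c^2 Q) has integral c ^- (m * n) * I, while convexity of exp
    gives exp (- Q) + (1 - c^2) Q exp (- Q) <= exp (- c^2 Q).  Integrating this for
    all c > 0, with equality at c = 1, leaves no choice for the integral of
    Q exp (- Q); its finiteness comes from any c < 1. *)
Lemma integral_quad_expN (I : R) :
  (\int[lebesgue_mx]_z (expR (- Q z))%:E = I%:E)%E ->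
  (\int[lebesgue_mx]_z (Q z * expR (- Q z))%:E =
   ((m * n)%:R / 2 * I)%:E)%E.
Proof.
move=> intI.
set J := (\int[_]_z (Q z * _)%:E)%E.
have J0 : (0 <= J)%E.
  by apply: integral_ge0 => z _; rewrite lee_fin mulr_ge0// expR_ge0.
have mexp (g : 'M[R]_(m, n) -> R) : measurable_fun setT g ->
    measurable_fun setT (fun z => expR (- g z)).
  by move=> mg; apply: measurableT_comp => //; exact: measurableT_comp.
have mQexp : measurable_fun setT (fun z => Q z * expR (- Q z)).
  by apply: measurable_funM => //; exact: mexp.
have mcQ (c : R) : measurable_fun setT (fun z => c * Q z) by exact: measurable_funM.
have lin c b : 0 <= b ->
    (\int[lebesgue_mx]_z (expR (- (c * Q z)) + b * (Q z * expR (- Q z)))%:E =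
     \int[lebesgue_mx]_z (expR (- (c * Q z)))%:E + b%:E * J)%E.
  move=> b0; have := @ge0_integral_lincomb _ _ R lebesgue_mx 1 b
    (fun z => expR (- (c * Q z))) (fun z => Q z * expR (- Q z))
    ler01 b0 (fun z => expR_ge0 _) (fun z => mulr_ge0 (Q0 z) (expR_ge0 _))
    (mexp _ (mcQ c)) mQexp.
  by rewrite mul1e; under eq_integral do rewrite mul1r.
have mlin c b : measurable_fun setT
    (fun z => (expR (- (c * Q z)) + b * (Q z * expR (- Q z)))%:E).
  apply/measurable_EFinP; apply: measurable_funD; first exact: mexp.
  exact: measurable_funM.
have lin0 c b z : 0 <= b ->
    (0 <= (expR (- (c * Q z)) + b * (Q z * expR (- Q z)))%:E)%E.
  by move=> b0; rewrite lee_fin addr_ge0 ?mulr_ge0 ?expR_ge0.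
have scaled c : 0 < c ->
    (\int[lebesgue_mx]_z (expR (- (c ^+ 2 * Q z)))%:E = (I / c ^+ (m * n))%:E)%E.
  move=> c0.
  have mE : measurable_fun setT (fun z => (expR (- Q z))%:E).
    by apply/measurable_EFinP; exact: mexp.
  have := @ge0_integral_affine_mx R m n c 0 (fun z => (expR (- Q z))%:E)
     (lt0r_neq0 c0) mE (fun z => expR_ge0 _).
  rewrite intI gtr0_norm// => intIc; rewrite EFinM -intIc.
  rewrite muleAC -EFinM divff ?lt0r_neq0 ?exprn_gt0// mul1e.
  by under [RHS]eq_integral do rewrite addr0 Q_homo.
have convex (c : R) z : expR (- Q z) + (1 - c ^+ 2) * (Q z * expR (- Q z))
    <= expR (- (c ^+ 2 * Q z)).
  rewrite (_ : - (c ^+ 2 * Q z) = (1 - c ^+ 2) * Q z - Q z); last by ring.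
  rewrite expRD mulrA -{1}(mul1r (expR (- Q z))) -mulrDl.
  by rewrite ler_wpM2r ?expR_ge0// expR_ge1Dx.
(* The convexity inequality is integrated on the two sides of c = 1 separately:
   integrals of nonnegative functions are additive, and 1 - c^2 changes sign. *)
have below c : 0 < c -> c <= 1 ->
    (I%:E + (1 - c ^+ 2)%:E * J <= (I / c ^+ (m * n))%:E)%E.
  move=> c0 c1; have c21 : 0 <= 1 - c ^+ 2 by nra.
  rewrite -scaled// -intI.
  under [X in (X + _)%E]eq_integral do rewrite -(mul1r (Q _)).
  rewrite -lin//; apply: ge0_le_integral => //.
  - by move=> z _; exact: lin0.
  - by apply/measurable_EFinP; exact: mexp.
  - by move=> z _; rewrite lee_fin mul1r.
have above c : 1 <= c ->
    (I%:E <= (I / c ^+ (m * n))%:E + (c ^+ 2 - 1)%:E * J)%E.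
  move=> c1; have c21 : 0 <= c ^+ 2 - 1 by nra.
  rewrite -scaled; last by lra.
  rewrite -lin// -intI; apply: ge0_le_integral => //.
  - by apply/measurable_EFinP; exact: mexp.
  - move=> z _; rewrite lee_fin; have := convex c z; lra.
have Jfin : J \is a fin_num.
  rewrite ge0_fin_numE// ltey; apply/eqP => Joo.
  have := below 2^-1; rewrite Joo invr_gt0 invf_le1// ltr0n ler1n => /(_ isT isT).
  by rewrite gt0_muley ?lte_fin//; lra.
rewrite -(fineK Jfin); congr EFin; set j := fine J.
have key c : 0 < c -> I + (1 - c ^+ 2) * j <= I / c ^+ (m * n).
  move=> c0; have [c1|/ltW c1] := leP c 1.
    by have := below c c0 c1; rewrite -(fineK Jfin) -EFinM -EFinD lee_fin.
  have := above c c1; rewrite -(fineK Jfin) -EFinM -EFinD lee_fin -/j; lra.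
(* With c = 1 / x the inequality becomes polynomial in x. *)
apply: ge0_deriv_at_1 => x x0; have := key x^-1.
rewrite invr_gt0 => /(_ x0); rewrite [in X in _ <= X]exprVn invrK => kx.
have x2 : 0 < x ^+ 2 by rewrite exprn_gt0.
have -> : I * (x ^+ (m * n).+2 - x ^+ 2) - j * (x ^+ 2 - 1) =
    x ^+ 2 * (I * x ^+ (m * n) - (I + (1 - x^-1 ^+ 2) * j)).
  by rewrite -addn2 exprD; field; rewrite lt0r_neq0.
by rewrite mulr_ge0 ?(ltW x2)// subr_ge0.
Qed.


End quadratic_exponential.

Lemma ge0_integral_shift_mx (R : realType) m n (v : 'M[R]_(m, n))
    (f : 'M[R]_(m, n) -> \bar R) :
  measurable_fun setT f -> (forall z, (0 <= f z)%E) ->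
  (\int[lebesgue_mx]_z f (z - v)%R = \int[lebesgue_mx]_z f z)%E.
Proof.
move=> mf f0; rewrite -(ge0_integral_affine_mx (- v) (oner_neq0 R) mf f0).
by rewrite normr1 expr1n mul1e; under [RHS]eq_integral do rewrite scale1r.
Qed.

Lemma ge0_integral_opp_mx (R : realType) m n (f : 'M[R]_(m, n) -> \bar R) :
  measurable_fun setT f -> (forall z, (0 <= f z)%E) ->
  (\int[lebesgue_mx]_z f (- z)%R = \int[lebesgue_mx]_z f z)%E.
Proof.
move=> mf f0; have N1 : -1 != 0 :> R by rewrite oppr_eq0 oner_neq0.
rewrite -(ge0_integral_affine_mx 0 N1 mf f0) normrN1 expr1n mul1e.
by under [RHS]eq_integral do rewrite scaleN1r addr0.
Qed.

Section gaussian_integrals.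
Context {R : realType} {m n p : nat}.
Variables (beta : R) (A : 'M[R]_(n, p)).
Hypothesis beta0 : 0 < beta.

Let gauss (z : 'M[R]_(m, n)) := expR (- (beta * frob_norm (z *m A) ^+ 2)).

Let mnorm (B : 'M[R]_(m, p)) :
  measurable_fun setT (fun z : 'M[R]_(m, n) => frob_norm (z *m A + B) ^+ 2).
Proof.
apply: measurable_frob_norm_sqr; apply: measurable_mxP => i j.
under eq_fun do rewrite mxE; apply: measurable_funD => //.
exact: (measurableT_comp (measurable_mx_entry i j) (measurable_mulmxr A)).
Qed.

Let mquad : measurable_fun setT (fun z : 'M[R]_(m, n) => beta * frob_norm (z *m A) ^+ 2).
Proof.
apply: measurable_funM; first exact: measurable_cst.
by apply: measurable_frob_norm_sqr; exact: measurable_mulmxr.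
Qed.

Lemma measurable_gauss : measurable_fun setT gauss.
Proof. by apply: measurableT_comp => //; exact: measurableT_comp. Qed.

Let measurable_EFin_gauss : measurable_fun setT (fun z => (gauss z)%:E).
Proof. by apply/measurable_EFinP; exact: measurable_gauss. Qed.

Let gauss0 z : 0 <= gauss z. Proof. exact: expR_ge0. Qed.

(** By the symmetry z |-> - z the integral is the same for B and - B, and in the
    sum of the two the parallelogram identity leaves only |z A|^2 and |B|^2. *)
Lemma gauss_second_moment (I : R) (B : 'M[R]_(m, p)) :
  (\int[lebesgue_mx]_z (gauss z)%:E = I%:E)%E ->
  (\int[lebesgue_mx]_z (frob_norm (z *m A + B) ^+ 2 * gauss z)%:E =
   (((m * n)%:R / (2 * beta) + frob_norm B ^+ 2) * I)%:E)%E.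
Proof.
move=> intI.
pose q (z : 'M[R]_(m, n)) := beta * frob_norm (z *m A) ^+ 2.
have q0 z : 0 <= q z := mulr_ge0 (ltW beta0) (sqr_ge0 _).
have qZ c z : q (c *: z) = c ^+ 2 * q z.
  by rewrite /q -scalemxAl frob_norm_sqrZ mulrCA.
have qmoment := integral_quad_expN mquad q0 qZ intI.
pose f C (z : 'M[R]_(m, n)) := frob_norm (z *m A + C) ^+ 2 * gauss z.
have mf C : measurable_fun setT (f C).
  by apply: measurable_funM (mnorm C) measurable_gauss.
have f0 C z : 0 <= f C z := mulr_ge0 (sqr_ge0 _) (gauss0 z).
set X := (\int[_]_z _)%E.
have XN : X = (\int[lebesgue_mx]_z (f (- B) z)%:E)%E.
  rewrite /X -(@ge0_integral_opp_mx _ _ _ (EFin \o f B)).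
  - apply: eq_integral => z _; rewrite /= /f /gauss !mulNmx.
    by rewrite (addrC _ B) -opprB !frob_norm_sqrN.
  - by apply/measurable_EFinP; exact: mf.
  - by move=> z; rewrite lee_fin; exact: f0.
have parallelogram z : 1 * f B z + 1 * f (- B) z =
    2 / beta * (q z * gauss z) + 2 * frob_norm B ^+ 2 * gauss z.
  rewrite /f /q !frob_norm_sqrD frob_norm_sqrN -scaleN1r frob_innerZr; field.
  exact: lt0r_neq0.
have mqg : measurable_fun setT (fun z => q z * gauss z).
  exact: measurable_funM mquad measurable_gauss.
have := @ge0_integral_lincomb _ _ R lebesgue_mx 1 1 (f B) (f (- B))
  ler01 ler01 (f0 _) (f0 _) (mf _) (mf _).
rewrite -XN !mul1e; under eq_integral do rewrite parallelogram.
rewrite (@ge0_integral_lincomb _ _ R lebesgue_mx (2 / beta) (2 * frob_norm B ^+ 2)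
  (fun z => q z * gauss z) gauss (divr_ge0 (ler0n _ 2) (ltW beta0))
  (mulr_ge0 (ler0n _ 2) (sqr_ge0 _)) (fun z => mulr_ge0 (q0 z) (gauss0 z))
  gauss0 mqg measurable_gauss).
rewrite qmoment intI -/X -!EFinM -EFinD.
case: X {XN} => [x| |]//; rewrite -EFinD => -[xx].
congr EFin; apply: (mulrI (x := 2%:R)); first by rewrite unitfE pnatr_eq0.
rewrite mulr_natl mulr2n -xx; field; exact: lt0r_neq0.
Qed.

(** All components have the same integral I by translation invariance, so the
    weights of the mixture are w j / sum w, whatever the value of I. *)
Lemma expectation_gauss_mixture d (Omega : measurableType d)
    (P : probability Omega R) (Z : {RV P >-> 'M[R]_(m, n)}) (J : finType)
    (w : J -> R) (mu : J -> 'M[R]_(m, n)) (u : 'M[R]_(m, n) -> R)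
    (eta : 'M[R]_(m, p)) :
  (forall j, 0 <= w j) ->
  (forall z, u z = \sum_j w j * gauss (z - mu j)) ->
  has_pdf Z (fun z : 'M[R]_(m, n) => (fine (\int[lebesgue_mx]_x (u x)%:E))^-1 * u z) ->
  ('E_P[fun o => (frob_norm (Z o *m A - eta) ^+ 2)%R] =
   (\sum_j w j / (\sum_i w i) *
     ((m * n)%:R / (2 * beta) + frob_norm (mu j *m A - eta) ^+ 2))%:E)%E.
Proof.
move=> w0 uE pdfZ.
have mg j : measurable_fun setT (fun z : 'M[R]_(m, n) => gauss (z - mu j)).
  apply: measurableT_comp measurable_gauss _.
  have := @measurable_affine_mx R m n 1 (- mu j).
  by under eq_fun do rewrite scale1r.
have mu_ : measurable_fun setT u.
  rewrite (_ : u = fun z => \sum_j w j * gauss (z - mu j)); last exact/funext.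
  by apply: measurable_sum => j; apply: measurable_funM (mg j).
have u0 z : 0 <= u z.
  by rewrite uE sumr_ge0// => j _; exact: mulr_ge0.
pose S := \sum_j w j; have S0 : 0 <= S by exact: sumr_ge0.
pose G := (\int[lebesgue_mx]_z (gauss z)%:E)%E.
have G0 : (0 <= G)%E by apply: integral_ge0 => z _; rewrite lee_fin.
pose U := (\int[lebesgue_mx]_z (u z)%:E)%E.
have U0 : (0 <= U)%E by apply: integral_ge0 => z _; rewrite lee_fin.
have shiftG j : (\int[lebesgue_mx]_z (gauss (z - mu j))%:E)%E = G.
  exact: (ge0_integral_shift_mx (mu j) measurable_EFin_gauss (fun z => gauss0 z)).
have UE : U = (S%:E * G)%E.
  rewrite /U; under eq_integral do rewrite uE.
  rewrite (ge0_integral_fincomb _ w0 (fun j (z : 'M[R]_(m, n)) => gauss0 (z - mu j)) mg).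
  rewrite /S -sumEFin ge0_sume_distrl; last by move=> j _; rewrite lee_fin.
  by apply: eq_bigr => j _; rewrite shiftG.
have k0 : 0 <= (fine U)^-1 by rewrite invr_ge0 fine_ge0.
have mass1 : ((fine U)^-1%:E * U = 1)%E.
  rewrite -(@probability_setT _ _ _ P) -(preimage_setT Z).
  rewrite [RHS](pdfZ setT measurableT) -/U.
  have := @ge0_integral_lincomb _ _ R lebesgue_mx (fine U)^-1 0 u u k0 (lexx 0)
    u0 u0 mu_ mu_.
  rewrite mul0e adde0 => <-; apply: eq_integral => z _.
  by rewrite mul0r addr0.
(* If the integral of u were infinite or zero, the normalizing constant would be
   0^-1 = 0, and the total mass 0 instead of 1. *)
have [I GI SI] : exists2 I : R, G = I%:E & S * I != 0.
  move: mass1; rewrite UE.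
  case: G G0 {UE shiftG} => [I| |]// _.
    rewrite -EFinM /= => -[] E; exists I => //; apply/eqP => SI0.
    by move: E; rewrite SI0 mulr0 => /esym/eqP; rewrite oner_eq0.
  have [S00|S00] := eqVneq S 0.
    by rewrite S00 mul0e /= mule0 => -[] /esym/eqP; rewrite oner_eq0.
  rewrite gt0_muley ?lte_fin ?lt0r ?S00//= invr0 mul0e => -[] /esym/eqP.
  by rewrite oner_eq0.
have fineU : fine U = S * I by rewrite UE GI -EFinM.
pose h (z : 'M[R]_(m, n)) := frob_norm (z *m A - eta) ^+ 2.
have mh : measurable_fun setT h by exact: mnorm.
have h0 z : 0 <= h z by exact: sqr_ge0.
pose a j := (S * I)^-1 * w j.
have a0 j : 0 <= a j by rewrite /a -fineU mulr_ge0.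
have EZ : ('E_P[fun o => (frob_norm (Z o *m A - eta) ^+ 2)%R] =
    \int[distribution P Z]_z (h z)%:E)%E.
  rewrite unlock ge0_integral_pushforward//.
  - exact/measurable_EFinP.
  - by move=> z _; rewrite lee_fin.
have hu z : h z * ((fine U)^-1 * u z) = \sum_j a j * (h z * gauss (z - mu j)).
  rewrite fineU uE !mulr_sumr; apply: eq_bigr => j _; rewrite /a; ring.
rewrite EZ (@ge0_integral_density _ _ _ lebesgue_mx _
   (fun z => (fine U)^-1 * u z)); last 5 first.
- by apply: measurable_funM mu_.
- by move=> z; exact: mulr_ge0.
- by move=> B mB; exact: pdfZ.
- exact/measurable_EFinP.
- by move=> z; rewrite lee_fin.
under eq_integral do rewrite -EFinM hu.
rewrite (ge0_integral_fincomb _ a0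
  (fun j (z : 'M[R]_(m, n)) => mulr_ge0 (h0 z) (gauss0 (z - mu j)))).
  rewrite -sumEFin; apply: eq_bigr => j _.
  pose f (z : 'M[R]_(m, n)) := frob_norm (z *m A + (mu j *m A - eta)) ^+ 2 * gauss z.
  have mf : measurable_fun setT (EFin \o f).
    by apply/measurable_EFinP; exact: measurable_funM (mnorm _) measurable_gauss.
  have f0 z : (0 <= (EFin \o f) z)%E.
    by rewrite lee_fin; exact: mulr_ge0 (sqr_ge0 _) (gauss0 z).
  have hf z : h z * gauss (z - mu j) = f (z - mu j).
    by rewrite /f /h mulmxBl addrA subrK.
  under eq_integral do rewrite hf.
  rewrite (ge0_integral_shift_mx (mu j) mf f0).
  rewrite (gauss_second_moment _ GI) -EFinM -/S /a; congr EFin.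
  move: SI; rewrite mulf_eq0 negb_or => /andP[S1 I1].
  by field; rewrite S1 I1 lt0r_neq0.
by move=> j; exact: measurable_funM.
Qed.

End gaussian_integrals.

(** * Orthogonal projection onto the column space *)

Section column_space_projection.
Context {R : realType} {N m : nat}.
Variable g : 'M[R]_(N, m).

Lemma frob_inner_eq0 k l (x : 'M[R]_(k, l)) : frob_inner x x = 0 -> x = 0.
Proof.
rewrite frob_innerE => x0; apply/matrixP => i j; rewrite mxE.
have c0 a : 0 <= \sum_b x b a * x b a.
  by apply: sumr_ge0 => b _; rewrite -expr2 sqr_ge0.
have cj0 := @psumr_eq0P _ _ _ _ (fun a _ => c0 a) x0 j isT.
have sq0 b : true -> 0 <= x b j * x b j by rewrite -expr2 sqr_ge0.
by apply/eqP; rewrite -sqrf_eq0 expr2 (psumr_eq0P sq0 cj0).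
Qed.

(** If v (g^T g) = 0 then |v g^T|^2 = v (g^T g) v^T = 0, and g^T has a right
    inverse. *)
Lemma gram_unitmx (L : 'M[R]_(m, N)) : L *m g = 1%:M -> g^T *m g \in unitmx.
Proof.
move=> Lg; rewrite -row_free_unit; apply: inj_row_free => v vgg.
have vg0 : v *m g^T = 0.
  apply: frob_inner_eq0; rewrite /frob_inner mxtrace_mulC trmx_mul trmxK.
  by rewrite -mulmxA (mulmxA g^T) [v *m _]mulmxA vgg mul0mx linear0.
by rewrite -[v]mulmx1 -(trmx1 _ m) -Lg trmx_mul mulmxA vg0 mul0mx.
Qed.

Hypothesis gg_unit : g^T *m g \in unitmx.
Let G := g *m invmx (g^T *m g) *m g^T.

Lemma col_projK : G *m g = g.
Proof. by rewrite -!mulmxA mulVmx// mulmx1. Qed.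

Lemma col_proj_sym : G^T = G.
Proof. by rewrite /G !trmx_mul trmxK trmx_inv trmx_mul trmxK mulmxA. Qed.

Lemma col_proj_idem : G *m G = G.
Proof. by rewrite {2}/G !mulmxA col_projK. Qed.

Lemma mxtrace_col_proj : \tr G = m%:R.
Proof. by rewrite /G -mulmxA mxtrace_mulC -mulmxA mulVmx// mxtrace1. Qed.

(** Both a (Y G) and W g^T have their rows in the column space of g, to which the
    rows of Y - Y G are orthogonal. *)
Lemma frob_norm_sqr_pythagoras k (Y : 'M[R]_(k, N)) (a : R) (W : 'M[R]_(k, m)) :
  frob_norm (a *: Y - W *m g^T) ^+ 2 =
  a ^+ 2 * frob_norm (Y - Y *m G) ^+ 2 +
  frob_norm (a *: (Y *m G) - W *m g^T) ^+ 2.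
Proof.
pose V := a *: (Y *m g *m invmx (g^T *m g)) - W.
have VE : a *: (Y *m G) - W *m g^T = V *m g^T.
  by rewrite /V mulmxBl -scalemxAl /G !mulmxA.
have -> : a *: Y - W *m g^T = a *: (Y - Y *m G) + V *m g^T.
  by rewrite -VE scalerBr addrA subrK.
rewrite VE (frob_norm_sqrD (a *: _)) frob_norm_sqrZ frob_innerZl.
suff -> : frob_inner (Y - Y *m G) (V *m g^T) = 0 by rewrite !mulr0 addr0.
rewrite /frob_inner mxtrace_mulC -mulmxA -trmx_mul.
by rewrite (mulmxBl Y) -(mulmxA Y) col_projK subrr linear0 mulmx0 linear0.
Qed.

End column_space_projection.

(** * Averages over resampled data *)

Section uniform_resampling.
Context {R : realType} {N : nat}.
Notation J := {ffun 'I_N -> 'I_N}.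

Lemma sum_ffun_coord (c : 'I_N -> R) (l : 'I_N) :
  N%:R * (\sum_(f : J) c (f l)) = N%:R ^+ N * \sum_k c k.
Proof.
pose F i k := if i == l then c k else 1.
transitivity (N%:R * \prod_i \sum_k F i k).
  congr (_ * _); rewrite (bigA_distr_bigA F); apply: eq_bigr => f _.
  rewrite (bigD1 l)//= /F eqxx big1 ?mulr1// => i /negPf ->; by [].
rewrite (bigD1 l)//= {1}/F eqxx.
have -> : \prod_(i | i != l) \sum_k F i k = N%:R ^+ N.-1.
  transitivity (\prod_(i < N | i != l) (N%:R : R)).
    apply: eq_bigr => i /negPf il; rewrite /F; under eq_bigr do rewrite il.
    by rewrite sumr_const card_ord.
  by rewrite prodr_const cardC1 card_ord.
rewrite mulrCA [RHS]mulrC; congr (_ * _).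
by case: N l {F c} => [[]|//] n l; rewrite -exprS.
Qed.

(** Two distinct coordinates of a uniform random map are independent. *)
Lemma sum_ffun_coord2 (a b : 'I_N -> R) (l l' : 'I_N) : l != l' ->
  \sum_k a k = 0 -> \sum_(f : J) a (f l) * b (f l') = 0.
Proof.
move=> ll' a0; pose F i k := if i == l then a k else if i == l' then b k else 1.
transitivity (\prod_i \sum_k F i k).
  rewrite (bigA_distr_bigA F); apply: eq_bigr => f _.
  rewrite (bigD1 l)//= (bigD1 l')/=; last by rewrite eq_sym.
  rewrite /F eqxx (negPf (_ : l' != l)) 1?eq_sym// eqxx big1 ?mulr1//.
  by move=> i /andP[/negPf -> /negPf ->].
by rewrite (bigD1 l)//= {1}/F eqxx a0 mul0r.
Qed.

Lemma sum_ffun_coord_eq0 (a : 'I_N -> R) (l : 'I_N) :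
  \sum_k a k = 0 -> \sum_(f : J) a (f l) = 0.
Proof.
move=> a0; have := sum_ffun_coord a l; rewrite a0 mulr0.
have N0 : N%:R != 0 :> R by rewrite pnatr_eq0 -lt0n; case: N l {a a0} => [[]|].
by move/eqP; rewrite mulf_eq0 (negPf N0)/= => /eqP.
Qed.

Variables (nu : nat) (eta : 'M[R]_(nu, N)).
Hypothesis eta0 : forall i, \sum_k eta i k = 0.

Lemma sum_resampled_eq0 : \sum_(f : J) colsub f eta = 0.
Proof.
apply/matrixP => i l; rewrite summxE mxE.
under eq_bigr do rewrite mxE.
exact: (sum_ffun_coord_eq0 l (eta0 i)).
Qed.

Lemma sum_resampled_gram :
  N%:R *: (\sum_(f : J) (colsub f eta)^T *m colsub f eta) =
  (N%:R ^+ N * frob_norm eta ^+ 2)%:M.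
Proof.
apply/matrixP => l l'; rewrite [LHS]mxE summxE [RHS]mxE.
under eq_bigr do rewrite mxE.
under eq_bigr do under eq_bigr do rewrite !mxE.
have [->|ll'] := eqVneq l l'.
  rewrite (sum_ffun_coord (fun k => \sum_i eta i k * eta i k)).
  by rewrite mulr1n frob_norm_sqr frob_innerE.
rewrite mulr0n exchange_big big1 ?mulr0// => i _.
exact: (sum_ffun_coord2 (eta i) ll' (eta0 i)).
Qed.

(** The cross term vanishes since the resampled data have mean zero.  Distinct
    resampled columns are uncorrelated, so the mean of their Gram matrix is
    (|eta|^2 / N) I, which against G G^T = G gives the factor tr G / N. *)
Lemma mean_resampled_distance (G : 'M[R]_N) (t : R) :
  (0 < N)%N -> G^T = G -> G *m G = G ->
  (N%:R ^+ N)^-1 *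
    \sum_(f : J) frob_norm (eta *m G - t *: (colsub f eta *m G)) ^+ 2 =
  frob_norm (eta *m G) ^+ 2 + t ^+ 2 * (\tr G / N%:R) * frob_norm eta ^+ 2.
Proof.
move=> N0 GT GG.
have N1 : N%:R != 0 :> R by rewrite pnatr_eq0 -lt0n.
have NN : N%:R ^+ N != 0 :> R by rewrite expf_neq0.
have cross : \sum_(f : J) frob_inner (eta *m G) (colsub f eta *m G) = 0.
  transitivity (frob_inner (eta *m G) ((\sum_(f : J) colsub f eta) *m G)).
    by rewrite /frob_inner mulmx_suml mulmx_sumr raddf_sum.
  by rewrite sum_resampled_eq0 mul0mx /frob_inner mulmx0 linear0.
have square : N%:R * \sum_(f : J) frob_norm (colsub f eta *m G) ^+ 2 =
    N%:R ^+ N * frob_norm eta ^+ 2 * \tr G.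
  transitivity (\tr (N%:R *: (\sum_(f : J) (colsub f eta)^T *m colsub f eta) *m G)).
    rewrite -scalemxAl linearZ/=; congr (_ * _).
    rewrite mulmx_suml raddf_sum; apply: eq_bigr => f _.
    rewrite frob_norm_sqr /frob_inner trmx_mul GT -mulmxA mxtrace_mulC -!mulmxA.
    by rewrite (mulmxA G) GG mulmxA mxtrace_mulC -(mulmxA G) mxtrace_mulC.
  by rewrite sum_resampled_gram mul_scalar_mx linearZ/=.
under eq_bigr do rewrite frob_norm_sqrD frob_norm_sqrN frob_norm_sqrZ
  -scaleNr frob_innerZr.
rewrite !big_split/= sumr_const card_ffun !card_ord.
rewrite -mulr_sumr -mulr_sumr cross !mulr0 addr0 -mulr_sumr.
apply: (mulfI NN); rewrite mulVKf// -[_ *+ (N ^ N)]mulr_natl natrX mulrDr; congr (_ + _).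
by apply: (mulfI N1); rewrite mulrCA square; field.
Qed.

End uniform_resampling.

(** * The relative distance for the diffusion-maps basis *)

Lemma frob_norm_sqr_cols (R : realType) m n (x : 'M[R]_(m, n)) :
  frob_norm x ^+ 2 = \sum_l frob_norm (col l x) ^+ 2.
Proof.
rewrite frob_norm_sqr frob_innerE; apply: eq_bigr => l _.
rewrite frob_norm_sqr frob_innerE big_ord1.
by apply: eq_bigr => i _; rewrite !mxE.
Qed.

Lemma diffusion_eigenvalue_gt0 (R : realType) nu N (eta : 'M[R]_(nu, N)) eps lam psi :
  diffusion_basis eta eps lam psi -> (1 < N)%N -> 0 < lam N ->
  forall a, (1 <= a <= N)%N -> 0 < lam a.
Proof.
move=> basis N1 lamN [|[|a]]// aN; first by rewrite (dm_lam1 basis).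
apply: (lt_le_trans lamN).
have mono k : (a.+2 + k <= N)%N -> lam (a.+2 + k)%N <= lam a.+2.
  elim: k => [|k IHk] akN; first by rewrite addn0.
  rewrite addnS; apply: (le_trans _ (IHk _)); last by rewrite ltnW// -addnS.
  by apply: (dm_lam_noninc basis); rewrite -addnS akN.
by have := mono (N - a.+2)%N; rewrite subnKC//; exact.
Qed.

Section reduced_basis.
Context {R : realType} {nu N : nat}.
Variables (eta : 'M[R]_(nu, N)) (kappa : nat) (eps : R).
Variables (lam : nat -> R) (psi : nat -> 'cV[R]_N).
Hypothesis basis : diffusion_basis eta eps lam psi.
Hypotheses (N1 : (1 < N)%N) (lamN : 0 < lam N).
Hypothesis data : normalized_data eta.
Hypothesis nu0 : (0 < nu)%N.

Notation J := {ffun 'I_N -> 'I_N}.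
Notation g := (g_mx kappa lam psi).
Notation G := (G_mx kappa lam psi).
Notation s := (@bw_s R nu N).
Notation shat := (@bw_shat R nu N).
Notation gbar := (g_mean eta kappa lam psi).
Notation r := (r_fun eta kappa lam psi).

(** The eigenvectors are orthonormal for the weight [b] and the eigenvalues are
    nonzero, so [b] psi^a / lambda_a^kappa is a dual family of g^a. *)
Lemma g_mx_left_inverse m : (m <= N)%N -> exists L : 'M[R]_(m, N), L *m g m = 1%:M.
Proof.
move=> mN.
exists (\matrix_(a < m, l < N)
   ((lam a.+1 ^+ kappa)^-1 * (dm_degree eta eps *m psi a.+1) l ord0)).
apply/matrixP => a b; rewrite !mxE.
have aN : (1 <= a.+1 <= N)%N by rewrite /= (leq_trans (ltn_ord a)).
have bN : (1 <= b.+1 <= N)%N by rewrite /= (leq_trans (ltn_ord b)).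
have := dm_orthonormal basis aN bN; rewrite frob_innerE big_ord1 eqSS => ab.
transitivity ((lam a.+1 ^+ kappa)^-1 * lam b.+1 ^+ kappa * (a == b :> nat)%:R).
  rewrite -ab mulr_sumr; apply: eq_bigr => l _; rewrite /g_vec !mxE; ring.
have [/val_inj ->|ab'] := eqVneq (a : nat) b.
  rewrite eqxx mulr1 mulVf// expf_neq0// lt0r_neq0//.
  exact: (diffusion_eigenvalue_gt0 basis).
by rewrite mulr0 (negPf (_ : a != b)).
Qed.

Lemma g_mx_gram_unit m : (m <= N)%N -> (g m)^T *m g m \in unitmx.
Proof. by move=> /g_mx_left_inverse[L]; exact: gram_unitmx. Qed.

Lemma G_mx_full : G N = 1%:M.
Proof.
have [L Lg] := g_mx_left_inverse (leqnn N).
have gu : g N \in unitmx by have [] := mulmx1_unit Lg.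
have := col_projK (g_mx_gram_unit (leqnn N)).
by move=> /(congr1 (mulmxr (invmx (g N)))); rewrite /= mulmxK// mulmxV.
Qed.

Lemma N_gt0 : 0 < N%:R :> R. Proof. by rewrite ltr0n ltnW. Qed.

Lemma N_sub1_gt0 : 0 < N%:R - 1 :> R. Proof. by rewrite subr_gt0 ltr1n. Qed.

Lemma data_row_sum i : \sum_k eta i k = 0.
Proof.
case: data => /matrixP/(_ i ord0); rewrite summxE mxE => + _.
by under eq_bigr do rewrite mxE.
Qed.

Lemma data_frob_norm : frob_norm eta ^+ 2 = nu%:R * (N%:R - 1).
Proof.
case: data => _ /(congr1 mxtrace); rewrite linearZ/= mxtrace1.
rewrite frob_norm_sqr /frob_inner mxtrace_mulC => <-.
by rewrite mulrC mulVKf// lt0r_neq0// N_sub1_gt0.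
Qed.

Lemma data_frob_norm_gt0 : 0 < frob_norm eta ^+ 2.
Proof. by rewrite data_frob_norm mulr_gt0 ?ltr0n// N_sub1_gt0. Qed.

Lemma bw_s_gt0 : 0 < s.
Proof.
by rewrite powR_gt0// divr_gt0// mulr_gt0 ?N_gt0//.
Qed.

(** This relation between the two bandwidths is what makes d2_sup independent of
    s and of the dimension nu. *)
Lemma bw_ratio : (shat / s) ^+ 2 * (s ^+ 2 + (N%:R - 1) / N%:R) = 1.
Proof.
have d0 : 0 < s ^+ 2 + (N%:R - 1) / N%:R.
  by rewrite addr_gt0 ?exprn_gt0 ?bw_s_gt0// divr_gt0 ?N_gt0 ?N_sub1_gt0.
rewrite /bw_shat (mulrAC s) divff ?lt0r_neq0 ?bw_s_gt0// mul1r exprVn sqr_sqrtr ?ltW//.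
by rewrite mulVf// lt0r_neq0.
Qed.

Lemma bw_shat_neq0 : shat != 0.
Proof.
apply/eqP => sh0; have := bw_ratio; rewrite sh0 mul0r expr0n mul0r => /esym/eqP.
by rewrite oner_eq0.
Qed.

(** Distributing the product of sums yields one term per choice j of a data point
    for every column; the columns recombine into a Frobenius norm, from which
    Pythagoras extracts the part that does not depend on z. *)
Lemma unnorm_pdf_mixture m (z : 'M[R]_(nu, m)) : (m <= N)%N ->
  unnorm_pdf eta kappa lam psi z =
  \sum_(j : J) gamma_j eta kappa lam psi m j *
    expR (- ((2 * shat ^+ 2)^-1 * frob_norm
      ((z - (shat / s) *: (colsub j eta *m g m *m invmx ((g m)^T *m g m)))
        *m (g m)^T) ^+ 2)).
Proof.
move=> mN; have gu := g_mx_gram_unit mN.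
rewrite /unnorm_pdf bigA_distr_bigA; apply: eq_bigr => j _.
rewrite -expR_sum /gamma_j -expRD; congr expR.
rewrite sumrN -mulr_sumr -opprD; congr (- _).
have -> : \sum_l frob_norm ((shat / s) *: col (j l) eta -
      \sum_(a < m) g m l a *: col a z) ^+ 2 =
    frob_norm ((shat / s) *: colsub j eta - z *m (g m)^T) ^+ 2.
  rewrite [RHS]frob_norm_sqr_cols; apply: eq_bigr => l _; congr (frob_norm _ ^+ 2).
  apply/matrixP => i k; rewrite !mxE summxE; congr (_ - _).
  by apply: eq_bigr => a _; rewrite !mxE mulrC.
rewrite (frob_norm_sqr_pythagoras gu) -/(G m).
have -> : (shat / s) *: (colsub j eta *m G m) - z *m (g m)^T =
    - ((z - (shat / s) *: (colsub j eta *m g m *m invmx ((g m)^T *m g m)))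
        *m (g m)^T).
  by rewrite mulmxBl opprB -scalemxAl /G_mx !mulmxA.
rewrite frob_norm_sqrN mulrDr; congr (_ + _); rewrite mulrA; congr (_ * _).
by field; rewrite bw_shat_neq0 lt0r_neq0// bw_s_gt0.
Qed.

Lemma g_meanE m : (m <= N)%N ->
  gbar m = frob_norm (eta *m G m) ^+ 2 / frob_norm eta ^+ 2 +
           (shat / s) ^+ 2 * (m%:R / N%:R).
Proof.
move=> mN; rewrite /g_mean /g_j -mulr_suml mulrA.
have gu := g_mx_gram_unit mN.
rewrite (mean_resampled_distance data_row_sum _ (ltnW N1) (col_proj_sym (g m))
  (col_proj_idem gu)) (mxtrace_col_proj gu).
by rewrite mulrDl mulfK// lt0r_neq0// data_frob_norm_gt0.
Qed.

Lemma g_mean_gt0 m : (1 <= m <= N)%N -> 0 < gbar m.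
Proof.
move=> /andP[m1 mN]; rewrite g_meanE// ltr_wpDl//.
  by rewrite divr_ge0 ?sqr_ge0.
rewrite mulr_gt0 ?divr_gt0 ?ltr0n ?(ltnW N1)//.
by rewrite exprn_even_gt0//= mulf_neq0 ?invr_neq0 ?bw_shat_neq0// lt0r_neq0// bw_s_gt0.
Qed.

Lemma sum_gamma_gt0 m : 0 < \sum_(j : J) gamma_j eta kappa lam psi m j.
Proof.
rewrite (bigD1 [ffun i => i])//= ltr_pwDl ?expR_gt0//.
by apply: sumr_ge0 => j _; rewrite expR_ge0.
Qed.

Lemma sum_p_j m : \sum_(j : J) p_j eta kappa lam psi m j = 1.
Proof. by rewrite -mulr_suml divff// lt0r_neq0// sum_gamma_gt0. Qed.

Lemma r_funE m : (1 <= m <= N)%N ->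
  r m * gbar m = \sum_(j : J) p_j eta kappa lam psi m j * g_j eta kappa lam psi m j.
Proof.
move=> mN; rewrite mulr_suml; apply: eq_bigr => j _.
by rewrite -mulrA divfK// lt0r_neq0// g_mean_gt0.
Qed.

(** With a complete basis G = 1, the residuals eta(j) - eta(j) G are zero and the
    weights p_j are uniform. *)
Lemma r_fun_full : r N = 1.
Proof.
have NN : (1 <= N <= N)%N by rewrite leqnn ltnW.
have gbar0 : gbar N != 0 by rewrite lt0r_neq0// g_mean_gt0.
have gamma1 (j : J) : gamma_j eta kappa lam psi N j = 1.
  rewrite /gamma_j G_mx_full mulmx1 subrr -(scale0r (0 : 'M[R]_(nu, N))).
  by rewrite frob_norm_sqrZ expr0n mul0r mulr0 oppr0 expR0.
have p1 (j : J) : p_j eta kappa lam psi N j = (N%:R ^+ N)^-1.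
  rewrite /p_j gamma1; under eq_bigr do rewrite gamma1.
  by rewrite sumr_const card_ffun !card_ord natrX mul1r.
apply: (mulIf gbar0); rewrite (r_funE NN).
by under eq_bigr do rewrite p1; rewrite -mulr_sumr mul1r.
Qed.

(** Splitting |(shat / s) eta(j) G - eta|^2 into |eta - eta G|^2 and
    |eta|^2 g_j shows that d2(m) is
    m shat^2 / (N - 1) + 1 - |eta G|^2 / |eta|^2 + r(m) gbar(m); subtracting gbar(m)
    in the form of [g_meanE] leaves exactly d2_sup(m). *)
Lemma d2E d (Omega : measurableType d) (P : probability Omega R)
    (Z : forall m : nat, {RV P >-> 'M[R]_(nu, m)}) m :
  (1 <= m <= N)%N -> has_pdf (Z m) (@pdf_Z R nu N eta kappa lam psi m) ->
  d2 eta kappa lam psi Z m = (@d2_sup R N m + (r m - 1) * gbar m)%:E.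
Proof.
move=> /andP[m1 mN] pdfZ; have gu := g_mx_gram_unit mN.
have beta0 : 0 < (2 * shat ^+ 2)^-1.
  by rewrite invr_gt0 mulr_gt0// exprn_even_gt0//= bw_shat_neq0.
rewrite /d2 (expectation_gauss_mixture beta0 eta (fun j => expR_ge0 _)
  (fun z => unnorm_pdf_mixture z mN) pdfZ) -EFinM; congr EFin.
have V0 := lt0r_neq0 data_frob_norm_gt0.
pose C := (nu * m)%:R * shat ^+ 2 + frob_norm (eta - eta *m G m) ^+ 2.
have step (j : J) :
    gamma_j eta kappa lam psi m j / (\sum_(i : J) gamma_j eta kappa lam psi m i) *
    ((nu * m)%:R / (2 * (2 * shat ^+ 2)^-1) + frob_norm
      ((shat / s) *: (colsub j eta *m g m *m invmx ((g m)^T *m g m)) *m (g m)^T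
        - eta) ^+ 2) =
    p_j eta kappa lam psi m j * C +
    p_j eta kappa lam psi m j * g_j eta kappa lam psi m j * frob_norm eta ^+ 2.
  rewrite -/(p_j eta kappa lam psi m j) -mulrA -mulrDr /g_j divfK//; congr (_ * _).
  rewrite -opprB frob_norm_sqrN -{1}(scale1r eta) (frob_norm_sqr_pythagoras gu).
  rewrite -/(G m) expr1n mul1r scale1r.
  have -> : (shat / s) *: (colsub j eta *m g m *m invmx ((g m)^T *m g m)) *m (g m)^T
      = (shat / s) *: (colsub j eta *m G m) by rewrite -scalemxAl /G_mx !mulmxA.
  by rewrite /C addrA; congr (_ + _ + _); field; rewrite bw_shat_neq0.
under eq_bigr do rewrite step.
rewrite big_split/= -[X in X + _]mulr_suml sum_p_j mul1r.
rewrite -[X in _ + X]mulr_suml -r_funE ?m1//.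
have resid : frob_norm (eta - eta *m G m) ^+ 2 =
    frob_norm eta ^+ 2 - frob_norm (eta *m G m) ^+ 2.
  have := frob_norm_sqr_pythagoras gu eta 1 (0 : 'M[R]_(nu, m)).
  by rewrite mul0mx !subr0 !scale1r expr1n mul1r => ->; rewrite addrK.
rewrite /C resid /d2_sup.
have ratio := bw_ratio.
have sn := lt0r_neq0 bw_s_gt0; have Nn := lt0r_neq0 N_gt0.
have N1n := lt0r_neq0 N_sub1_gt0.
have shatE : shat ^+ 2 / (N%:R - 1) + (shat / s) ^+ 2 / N%:R = (N%:R - 1)^-1.
  transitivity ((N%:R - 1)^-1 * ((shat / s) ^+ 2 * (s ^+ 2 + (N%:R - 1) / N%:R))).
    by field; rewrite N1n sn Nn.
  by rewrite ratio mulr1.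
have -> : m%:R / (N%:R - 1) =
   m%:R * (shat ^+ 2 / (N%:R - 1)) + (shat / s) ^+ 2 * (m%:R / N%:R) :> R.
  by rewrite -(congr1 ( *%R m%:R) shatE); ring.
rewrite -addrA mulrDl mulrDl mulfK// natrM.
have -> : nu%:R * m%:R * shat ^+ 2 / frob_norm eta ^+ 2 =
    m%:R * (shat ^+ 2 / (N%:R - 1)).
  by rewrite data_frob_norm; field; rewrite N1n pnatr_eq0 -lt0n nu0.
rewrite mulrBl divff// (g_meanE mN); ring.
Qed.

End reduced_basis.

(** * Minima over a range, and the theorem *)

Lemma min_range_le disp (T : orderType disp) a b k (f : nat -> T) :
  (a <= k <= b)%N -> (min_range a b f <= f k)%O.
Proof.
move=> /andP[ak kb]; rewrite /min_range.
by apply: (@ge_bigmin_seq _ _ _ _ _ k) => //; rewrite mem_index_iota ak ltnS.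
Qed.

Lemma le_min_range disp (T : orderType disp) a b (f : nat -> T) x : (a <= b)%N ->
  (forall k, (a <= k <= b)%N -> (x <= f k)%O) -> (x <= min_range a b f)%O.
Proof.
move=> ab xf; rewrite /min_range big_seq_cond; apply: le_bigmin => [|k].
  by apply: xf; rewrite ab leqnn.
by rewrite andbT mem_index_iota ltnS => /xf.
Qed.

Theorem theorem4 (R : realType) (nu N : nat) (eta : 'M[R]_(nu, N))
    (kappa : nat) (eps_opt : R) (m_opt : nat)
    (lam : nat -> R) (psi : nat -> 'cV[R]_N)
    (d : measure_display) (Omega : measurableType d) (P : probability Omega R)
    (Z : forall m : nat, {RV P >-> 'M[R]_(nu, m)})
    (hnu : (1 <= nu)%N) (hnuN : (nu < N)%N)
    (heta : normalized_data eta)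
    (heps : 0 < eps_opt)
    (hm_opt : (2 < m_opt)%N) (hm_optN : (m_opt < N)%N)
    (hK : posdef_mx (dm_kernel eta eps_opt))
    (hbasis : diffusion_basis eta eps_opt lam psi)
    (hgap : lam m_opt.+1 < lam m_opt)
    (hlamN : 0 < lam N)
    (hZ : forall m : nat, (1 <= m <= N)%N ->
       has_pdf (Z m) (@pdf_Z R nu N eta kappa lam psi m))
    (hr : forall m : nat, (m_opt <= m <= N)%N ->
       r_fun eta kappa lam psi m <= 1) :
  [/\ (min_range m_opt N (d2 eta kappa lam psi Z)
         <= (min_range m_opt N (@d2_sup R N))%:E)%E,
      ((min_range m_opt N (@d2_sup R N))%:E < d2 eta kappa lam psi Z N)%E,
      (min_range m_opt N (d2 eta kappa lam psi Z)
         <= (1 + m_opt%:R / (N%:R - 1))%:E)%E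
    & ((1 + m_opt%:R / (N%:R - 1))%:E < d2 eta kappa lam psi Z N)%E].
Proof.
have N1 : (1 < N)%N by rewrite (leq_trans _ hnuN).
have mopt1 : (1 <= m_opt)%N by rewrite (leq_trans _ hm_opt).
have d2_formula m : (m_opt <= m <= N)%N -> d2 eta kappa lam psi Z m =
    (@d2_sup R N m + (r_fun eta kappa lam psi m - 1) * g_mean eta kappa lam psi m)%:E.
  move=> /andP[optm mN].
  have m1N : (1 <= m <= N)%N by rewrite (leq_trans mopt1).
  by rewrite (d2E hbasis N1 hlamN heta hnu m1N (hZ m m1N)).
have d2_le m : (m_opt <= m <= N)%N ->
    (d2 eta kappa lam psi Z m <= (@d2_sup R N m)%:E)%E.
  move=> mr; rewrite d2_formula// lee_fin gerDl mulr_le0_ge0 ?subr_le0 ?hr// ltW//.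
  move: mr => /andP[optm mN].
  by apply: (g_mean_gt0 _ hbasis N1 hlamN heta hnu); rewrite (leq_trans mopt1).
have d2N : d2 eta kappa lam psi Z N = (@d2_sup R N N)%:E.
  have NN : (m_opt <= N <= N)%N by rewrite leqnn ltnW.
  rewrite (d2_formula N NN) (r_fun_full kappa hbasis N1 hlamN heta hnu).
  by rewrite subrr mul0r addr0.
have d2_sup_mono : {homo @d2_sup R N : m n / (m <= n)%N >-> m <= n}.
  move=> m n mn; rewrite lerD2l ler_wpM2r ?ler_nat// invr_ge0 ltW// N_sub1_gt0//.
have optN : (m_opt <= m_opt <= N)%N by rewrite leqnn ltnW.
have minE : min_range m_opt N (@d2_sup R N) = @d2_sup R N m_opt.
  apply/eqP; rewrite eq_le (min_range_le _ optN) /=.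
  by apply: (le_min_range (ltnW hm_optN)) => k /andP[/d2_sup_mono].
have min_d2_le : (min_range m_opt N (d2 eta kappa lam psi Z) <=
    (@d2_sup R N m_opt)%:E)%E.
  by apply: (le_trans (min_range_le _ optN)); exact: d2_le.
have sup_lt : ((@d2_sup R N m_opt)%:E < d2 eta kappa lam psi Z N)%E.
  by rewrite d2N lte_fin ltrD2l ltr_pM2r ?ltr_nat// invr_gt0 N_sub1_gt0.
by rewrite minE; split.
Qed.
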